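(* Let $Q$ be a unital quantale, $M$ a left $Q$-module, and $X\subseteq M$ a set of generators of $M$. Then $M$ is a projective object in the category of left $Q$-modules if and only if there exists $k\in Q^{X\times X}$ with $k\star k = k$ such that $M$ is isomorphic to the submodule of $Q^X$ generated by the functions $k(x,\_) \in Q^X$, $x\in X$.
   Context: A quantale is a complete lattice with an associative multiplication distributing over arbitrary joins in both arguments; unital if it has a multiplicative unit $1$. A left $Q$-module is a complete lattice $M$ with a scalar multiplication $\ast:Q\times M\to M$ such that $(ab)\ast v = a\ast(b\ast v)$, $1\ast v=v$, and $\ast$ distributes over arbitrary joins in both arguments; morphisms are join-preserving maps commuting with scalar multiplication. $Q^X$ denotes the module of functions $X\to Q$ with pointwise joins and scalar multiplication (the free left $Q$-module on $X$). For $k\in Q^{X\times X}$ and $x\in X$, $k(x,\_)$ is the function $y\mapsto k(x,y)$ in $Q^X$. The product on $Q^{X\times X}$ is $(h\star k)(x,y) = \bigvee_{z\in X} h(x,z)\cdot k(z,y)$. *)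

(* Defs.v *)
From HB Require Import structures.
From mathcomp Require Import all_boot all_order.
From mathcomp Require Import boolp classical_sets functions.

Set Implicit Arguments.
Unset Strict Implicit.
Unset Printing Implicit Defensive.

Import Order.TTheory.
Local Open Scope classical_set_scope.

Reserved Notation "a *> v" (at level 40, v at next level).

(* Displays only steer the printing of orders, so one is fixed once and for
   all, as [ring_display] is for numeric types. *)
Fact quantale_display : Order.disp_t. Proof. exact: (Order.Disp tt tt). Qed.

(* Arbitrary infima come for free as joins of sets of lower bounds, see
   [bigvee_lbound] below. *)
HB.mixin Record POrder_isCompleteLattice T
    of Order.POrder quantale_display T := {
  bigvee : set T -> T;
  bigveeP : forall A : set T, supremums A (bigvee A)
}.

#[short(type="completeLatticeType")]
HB.structure Definition CompleteLattice :=
  {T of Order.POrder quantale_display T & POrder_isCompleteLattice T}.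

Lemma bigvee_ub (T : completeLatticeType) (A : set T) x :
  A x -> (x <= bigvee A)%O.
Proof. exact: (bigveeP A).1. Qed.

Lemma bigvee_le (T : completeLatticeType) (A : set T) y :
  (forall x, A x -> (x <= y)%O) -> (bigvee A <= y)%O.
Proof. exact: (bigveeP A).2. Qed.

Lemma bigvee_lbound (T : completeLatticeType) (A : set T) :
  lbound A (bigvee (lbound A)) /\ ubound (lbound A) (bigvee (lbound A)).
Proof.
split; last by move=> x; exact: bigvee_ub.
by move=> x Ax; apply: bigvee_le => y; exact.
Qed.

HB.mixin Record CompleteLattice_Semigroup_isQuantale Q
    of CompleteLattice Q & Semigroup Q := {
  mul_bigveel : forall (A : set Q) (b : Q),
    (bigvee A * b)%g = bigvee [set (a * b)%g | a in A];
  mul_bigveer : forall (a : Q) (B : set Q),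
    (a * bigvee B)%g = bigvee [set (a * b)%g | b in B]
}.

#[short(type="quantaleType")]
HB.structure Definition Quantale :=
  {Q of CompleteLattice Q & Semigroup Q &
        CompleteLattice_Semigroup_isQuantale Q}.

#[short(type="unitalQuantaleType")]
HB.structure Definition UnitalQuantale := {Q of Quantale Q & Monoid Q}.

HB.mixin Record CompleteLattice_isLeftModule (Q : unitalQuantaleType) M
    of CompleteLattice M := {
  qscale : Q -> M -> M;
  qscaleA : forall (a b : Q) (v : M),
    qscale (a * b)%g v = qscale a (qscale b v);
  qscale1 : forall v : M, qscale 1%g v = v;
  qscale_bigveel : forall (A : set Q) (v : M),
    qscale (bigvee A) v = bigvee [set qscale a v | a in A];
  qscale_bigveer : forall (a : Q) (V : set M),
    qscale a (bigvee V) = bigvee [set qscale a v | v in V]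
}.

#[short(type="leftQModType")]
HB.structure Definition LeftQMod (Q : unitalQuantaleType) :=
  {M of CompleteLattice M & CompleteLattice_isLeftModule Q M}.

Notation "a *> v" := (qscale a v) : classical_set_scope.

Section Category.
Variable Q : unitalQuantaleType.
Implicit Types M N P : leftQModType Q.

Definition is_qmorph M N (f : M -> N) : Prop :=
  (forall A : set M, f (bigvee A) = bigvee (f @` A)) /\
  (forall (a : Q) (v : M), f (a *> v) = a *> f v).

Definition is_epi M N (e : M -> N) : Prop :=
  is_qmorph e /\
  forall P (g h : N -> P), is_qmorph g -> is_qmorph h ->
    g \o e = h \o e -> g = h.

Definition projective M : Prop :=
  forall N P (e : N -> P) (f : M -> P), is_epi e -> is_qmorph f ->
    exists2 g : M -> N, is_qmorph g & e \o g = f.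

Definition qmod_iso M N : Prop :=
  exists (f : M -> N) (g : N -> M),
    [/\ is_qmorph f, is_qmorph g, cancel f g & cancel g f].

End Category.

(* An alias of the function type, since the latter already carries the
   pointwise order under another display. *)
Definition qpow (Q : unitalQuantaleType) (X : Type) : Type := X -> Q.

Section FunctionModule.
Variables (Q : unitalQuantaleType) (X : Type).

HB.instance Definition _ := gen_eqMixin (qpow Q X).
HB.instance Definition _ := gen_choiceMixin (qpow Q X).
HB.instance Definition _ :=
  @Order.isPOrder.Build quantale_display (qpow Q X)
    (@FunOrder.lef X _ Q) (@FunOrder.ltf X _ Q) (@FunOrder.ltf_def X _ Q)
    (@FunOrder.lef_refl X _ Q) (@FunOrder.lef_anti X _ Q)
    (@FunOrder.lef_trans X _ Q).

Definition qpow_bigvee (A : set (qpow Q X)) : qpow Q X :=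
  fun x => bigvee [set f x | f in A].

Lemma qpow_bigveeP (A : set (qpow Q X)) : supremums A (qpow_bigvee A).
Proof.
split=> [f Af | g ubg].
- by apply/asboolP => x; apply: bigvee_ub; exists f.
- apply/asboolP => x; apply: bigvee_le => _ [f Af <-].
  by have /asboolP := ubg f Af; exact.
Qed.

HB.instance Definition _ :=
  POrder_isCompleteLattice.Build (qpow Q X) qpow_bigveeP.

Definition qpow_scale (a : Q) (f : qpow Q X) : qpow Q X :=
  fun x => (a * f x)%g.

Lemma qpow_scaleA a b f :
  qpow_scale (a * b)%g f = qpow_scale a (qpow_scale b f).
Proof. by apply/funext => x; rewrite /qpow_scale mulgA. Qed.

Lemma qpow_scale1 f : qpow_scale 1%g f = f.
Proof. by apply/funext => x; rewrite /qpow_scale mul1g. Qed.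

Lemma qpow_scale_bigveel (A : set Q) f :
  qpow_scale (bigvee A) f = bigvee [set qpow_scale a f | a in A].
Proof.
apply/funext => x; rewrite /qpow_scale mul_bigveel.
by rewrite [RHS]/(qpow_bigvee _ x) /qpow_bigvee image_comp.
Qed.

Lemma qpow_scale_bigveer a (F : set (qpow Q X)) :
  qpow_scale a (bigvee F) = bigvee [set qpow_scale a f | f in F].
Proof.
apply/funext => x; rewrite /qpow_scale mul_bigveer.
by rewrite [RHS]/(qpow_bigvee _ x) /qpow_bigvee !image_comp.
Qed.

HB.instance Definition _ := CompleteLattice_isLeftModule.Build Q (qpow Q X)
  qpow_scaleA qpow_scale1 qpow_scale_bigveel qpow_scale_bigveer.

End FunctionModule.

Section Generation.
Variables (Q : unitalQuantaleType) (M : leftQModType Q).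

Definition is_submodule (S : set M) : Prop :=
  (forall A : set M, A `<=` S -> S (bigvee A)) /\
  (forall (a : Q) (v : M), S v -> S (a *> v)).

Definition qspan (G : set M) : set M := smallest is_submodule G.

Definition generates (G : set M) : Prop := qspan G = setT.

Lemma qspan_submodule G : is_submodule (qspan G).
Proof.
split=> [A sAG | a v Gv] S [subS sGS].
- by apply: subS.1 => v /sAG; apply.
- by apply: subS.2; apply: Gv.
Qed.

Definition gen_submod (G : set M) : Type := {v : M | v \in qspan G}.

End Generation.

Section GeneratedSubmodule.
Variables (Q : unitalQuantaleType) (M : leftQModType Q) (G : set M).
Local Notation S := (gen_submod G).

HB.instance Definition _ := SubChoice.on S.
HB.instance Definition _ :=
  [SubChoice_isSubPOrder of S by <: with quantale_display].

Lemma gen_submodP (u : S) : qspan G (val u).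
Proof. by apply: set_mem; exact: valP. Qed.

Lemma val_bigvee_subproof (A : set S) : bigvee (val @` A) \in qspan G.
Proof.
apply/mem_set; apply: (qspan_submodule G).1 => _ [u _ <-].
exact: gen_submodP.
Qed.

Definition gen_submod_bigvee (A : set S) : S :=
  exist _ (bigvee (val @` A)) (val_bigvee_subproof A).

Lemma gen_submod_bigveeP (A : set S) : supremums A (gen_submod_bigvee A).
Proof.
split=> [u Au | w ubw]; rewrite -Order.le_val /=.
- by apply: bigvee_ub; exists u.
- by apply: bigvee_le => _ [u Au <-]; have := ubw _ Au; rewrite -Order.le_val.
Qed.

HB.instance Definition _ :=
  POrder_isCompleteLattice.Build S gen_submod_bigveeP.

Lemma val_scale_subproof (a : Q) (u : S) : a *> val u \in qspan G.
Proof.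
by apply/mem_set; apply: (qspan_submodule G).2; exact: gen_submodP.
Qed.

Definition gen_submod_scale (a : Q) (u : S) : S :=
  exist _ (a *> val u) (val_scale_subproof a u).

Lemma gen_submod_scaleA a b u :
  gen_submod_scale (a * b)%g u = gen_submod_scale a (gen_submod_scale b u).
Proof. by apply: val_inj; rewrite /= qscaleA. Qed.

Lemma gen_submod_scale1 u : gen_submod_scale 1%g u = u.
Proof. by apply: val_inj; rewrite /= qscale1. Qed.

Lemma gen_submod_scale_bigveel (A : set Q) u :
  gen_submod_scale (bigvee A) u = bigvee [set gen_submod_scale a u | a in A].
Proof. by apply: val_inj; rewrite /= qscale_bigveel image_comp. Qed.

Lemma gen_submod_scale_bigveer a (V : set S) :
  gen_submod_scale a (bigvee V) = bigvee [set gen_submod_scale a u | u in V].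
Proof. by apply: val_inj; rewrite /= qscale_bigveer !image_comp. Qed.

HB.instance Definition _ := CompleteLattice_isLeftModule.Build Q S
  gen_submod_scaleA gen_submod_scale1
  gen_submod_scale_bigveel gen_submod_scale_bigveer.

End GeneratedSubmodule.

Definition kstar (Q : unitalQuantaleType) (X : Type)
    (h k : qpow Q (X * X)) : qpow Q (X * X) :=
  fun p => bigvee (range (fun z : X => (h (p.1, z) * k (z, p.2))%g)).

Definition krow (Q : unitalQuantaleType) (X : Type)
    (k : qpow Q (X * X)) (x : X) : qpow Q X :=
  fun y => k (x, y).

(* Main.v *)
Require Import Defs.
From HB Require Import structures.
From mathcomp Require Import all_boot all_order.
From mathcomp Require Import boolp classical_sets functions.

(** A module is projective iff it is a retract of the free module [Q^X] on a
    generating set [X].  If [s] is a section of the canonical map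
    [pi : Q^X -> M], then [k(x, y) = s(x)(y)] is idempotent, because
    [s \o pi \o s = s], and [s] identifies [M] with the span of the rows of [k];
    conversely, an idempotent [k] makes [h |-> \/_x h(x) *> k(x, _)] a
    retraction of [Q^X] onto the span of its rows.  Freeness of [Q^X]
    gives projectivity once epimorphisms are known to be surjective.  This is
    seen by testing against the dual module [Q^op], on which [a] acts by the residual
    [q |-> max {b | b * a <= q}]: every [p] in a module [P] defines a morphism
    [v |-> max {a | a *> v <= p}] from [P] to [Q^op], and for [e : N -> P] the
    morphisms defined by [p] and by the largest element of the image of [e]
    below [p] agree on that image. *)

Set Implicit Arguments.
Unset Strict Implicit.
Unset Printing Implicit Defensive.

Import Order.TTheory.
Local Open Scope classical_set_scope.

(** Antisymmetry in Yoneda form: joins are known through their upper bounds, so equations between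
    them reduce to equivalences of inequalities. *)
Lemma eq_le_above (d : Order.disp_t) (T : porderType d) (x y : T) :
  (forall z, (x <= z)%O <-> (y <= z)%O) -> x = y.
Proof. by move=> xy; apply: le_anti; apply/andP; split; apply/xy. Qed.

Section CompleteLatticeTheory.
Variables (T : completeLatticeType) (I : Type).
Implicit Types (A : set I) (F : I -> T).

Lemma bigvee_imageP A F (y : T) :
  (bigvee (F @` A) <= y)%O <-> (forall i, A i -> (F i <= y)%O).
Proof.
split=> [Fy i Ai|Fy]; last by apply: bigvee_le => _ [i Ai <-]; exact: Fy.
by apply: le_trans Fy; apply: bigvee_ub; exists i.
Qed.

Lemma bigvee_rangeP F (y : T) :
  (bigvee (range F) <= y)%O <-> (forall i, (F i <= y)%O).
Proof. by rewrite bigvee_imageP; split=> Fy i //; exact: Fy. Qed.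

End CompleteLatticeTheory.

Lemma bigvee_leP (T : completeLatticeType) (A : set T) (y : T) :
  (bigvee A <= y)%O <-> (forall x, A x -> (x <= y)%O).
Proof. by rewrite -(bigvee_imageP A id) image_id. Qed.

Lemma bigvee_mono (T U : completeLatticeType) (f : T -> U) :
  (forall A, f (bigvee A) = bigvee (f @` A)) ->
  {homo f : x y / (x <= y)%O}.
Proof.
move=> fV x y xy; have -> : y = bigvee [set x; y].
  apply: eq_le_above => z; rewrite bigvee_leP.
  by split=> [yz _ [->|->]//|]; [exact: le_trans yz|apply; right].
by rewrite fV; apply: bigvee_ub; exists x => //; left.
Qed.

(** * Residuals of the scalar action *)

Section Residual.
Variables (Q : unitalQuantaleType) (M : leftQModType Q).

Definition qres (v p : M) : Q := bigvee [set a | (a *> v <= p)%O].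

(** Residuation: the join defining [qres v p] lies in its own set, because scaling preserves joins
    of scalars. *)
Lemma le_qres (v p : M) (a : Q) : (a <= qres v p)%O <-> (a *> v <= p)%O.
Proof.
split=> [le_a|le_p]; last exact: bigvee_ub.
apply: le_trans (bigvee_mono (f := fun a => a *> v) _ le_a) _.
  by move=> A; exact: qscale_bigveel.
by rewrite qscale_bigveel; apply/bigvee_imageP.
Qed.

End Residual.

(** * The dual module: [Q] with the reversed order *)

Definition qdual (Q : unitalQuantaleType) : Type := Q.

Section DualModule.
Variable Q : unitalQuantaleType.
Implicit Types (a b : Q) (q : qdual Q).

HB.instance Definition _ := Choice.on (qdual Q).

Definition qdual_le : rel (qdual Q) := fun x y => ((y : Q) <= (x : Q))%O.

Lemma qdual_le_refl : reflexive qdual_le.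
Proof. by move=> x; exact: lexx. Qed.

Lemma qdual_le_anti : antisymmetric qdual_le.
Proof. by move=> x y; rewrite andbC; exact: le_anti. Qed.

Lemma qdual_le_trans : transitive qdual_le.
Proof. by move=> x y z yx xz; exact: le_trans xz yx. Qed.

HB.instance Definition _ := @Order.Le_isPOrder.Build quantale_display (qdual Q)
  qdual_le qdual_le_refl qdual_le_anti qdual_le_trans.

Lemma qdual_leE (x y : qdual Q) : (x <= y)%O = ((y : Q) <= (x : Q))%O.
Proof. by []. Qed.

Definition qdual_bigvee (A : set (qdual Q)) : qdual Q :=
  bigvee (lbound (A : set Q)).

Lemma qdual_bigveeP (A : set (qdual Q)) : supremums A (qdual_bigvee A).
Proof. exact: bigvee_lbound. Qed.

HB.instance Definition _ :=
  POrder_isCompleteLattice.Build (qdual Q) qdual_bigveeP.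

Definition qdual_scale a q : qdual Q :=
  bigvee [set b : Q | ((b * a)%g <= (q : Q))%O].

(** The same adjunction for right multiplication by [a]; the reversed order makes [qdual_scale a] a
    left adjoint, hence join-preserving. *)
Lemma qdual_scale_le a q b :
  (qdual_scale a q <= (b : qdual Q))%O <-> (q <= ((b * a)%g : qdual Q))%O.
Proof.
rewrite !qdual_leE; split=> [le_b|le_q]; last exact: bigvee_ub.
apply: le_trans (bigvee_mono (f := fun b => (b * a)%g) _ le_b) _.
  by move=> A; exact: mul_bigveel.
by rewrite mul_bigveel; apply/bigvee_imageP.
Qed.

Lemma qdual_scaleA a b q :
  qdual_scale (a * b)%g q = qdual_scale a (qdual_scale b q).
Proof. by apply: eq_le_above => c; rewrite !qdual_scale_le mulgA. Qed.

Lemma qdual_scale1 q : qdual_scale 1%g q = q.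
Proof. by apply: eq_le_above => c; rewrite qdual_scale_le mulg1. Qed.

Lemma qdual_scale_bigveel (A : set Q) q :
  qdual_scale (bigvee A) q = bigvee [set qdual_scale a q | a in A].
Proof.
apply: eq_le_above => c; rewrite qdual_scale_le bigvee_imageP.
rewrite qdual_leE mul_bigveer bigvee_imageP.
by split=> cA a /cA; rewrite qdual_scale_le.
Qed.

Lemma qdual_scale_bigveer a (V : set (qdual Q)) :
  qdual_scale a (bigvee V) = bigvee [set qdual_scale a v | v in V].
Proof.
apply: eq_le_above => c; rewrite qdual_scale_le bigvee_imageP bigvee_leP.
by split=> cV v /cV; rewrite qdual_scale_le.
Qed.

HB.instance Definition _ := CompleteLattice_isLeftModule.Build Q (qdual Q)
  qdual_scaleA qdual_scale1 qdual_scale_bigveel qdual_scale_bigveer.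

(** By [le_qres], [qres v p <= c] in the reversed order means [c *> v <= p], a condition that turns
    joins in [v] into conjunctions and scalars into products. *)
Lemma qres_morph (M : leftQModType Q) (p : M) :
  is_qmorph (fun v => qres v p : qdual Q).
Proof.
split=> [A|a v]; apply: eq_le_above => c.
- rewrite qdual_leE le_qres qscale_bigveer !bigvee_imageP.
  by split=> cA v /cA; rewrite qdual_leE le_qres.
- by rewrite qdual_scale_le !qdual_leE !le_qres qscaleA.
Qed.

End DualModule.

(** * Epimorphisms are the surjective morphisms *)

Section Morphisms.
Variable Q : unitalQuantaleType.
Implicit Types M N P : leftQModType Q.

Lemma qmorph_comp M N P (g : N -> P) (f : M -> N) :
  is_qmorph g -> is_qmorph f -> is_qmorph (g \o f).
Proof.
move=> [gV gZ] [fV fZ]; split=> [A|a v] /=; last by rewrite fZ gZ.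
by rewrite fV gV image_comp.
Qed.

Lemma qmorph_id M : is_qmorph (@id M).
Proof. by split=> // A; rewrite image_id. Qed.

Lemma epi_surjective N P (e : N -> P) : is_epi e -> range e = setT.
Proof.
move=> [[eV eZ] eI]; apply/seteqP; split=> // p _.
(* As [e] preserves joins, [e n] is the largest element of the image below [p]. *)
pose n := bigvee [set m | (e m <= p)%O].
have en_le m : (e m <= e n)%O <-> (e m <= p)%O.
  split=> [/le_trans|]; first by apply; rewrite eV; apply/bigvee_imageP.
  by move=> em; apply: (bigvee_mono eV); exact: bigvee_ub.
have /(congr1 (fun f => f p)) /= Enp :
    (fun v => qres v p : qdual Q) = (fun v => qres v (e n)).
  apply: eI; [exact: qres_morph|exact: qres_morph|].
  apply/funext => m /=; apply: eq_le_above => c.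
  by rewrite !qdual_leE !le_qres -eZ en_le.
exists n => //; apply: le_anti; apply/andP; split; first exact/(en_le n).
(* Since [1 *> p <= p], the unit lies below [qres p p = qres p (e n)], that is, [p <= e n]. *)
rewrite -[X in (X <= _)%O]qscale1; apply/le_qres; rewrite -Enp.
by apply/le_qres; rewrite qscale1.
Qed.

Lemma surjective_epi N P (e : N -> P) :
  is_qmorph e -> range e = setT -> is_epi e.
Proof.
move=> eM e_surj; split=> // R g h _ _ gh; apply/funext => p.
have [n _ <-] : range e p by rewrite e_surj.
by have := congr1 (fun f => f n) gh.
Qed.

End Morphisms.

(** * Free modules and their retracts *)

Section Free.
Variables (Q : unitalQuantaleType) (X : Type).
Implicit Types M N : leftQModType Q.

(** The morphism out of the free module that extends [v], see [qlin_qunit]. *)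
Definition qlin M (v : X -> M) (h : qpow Q X) : M :=
  bigvee (range (fun x => h x *> v x)).

Lemma qlin_morph M (v : X -> M) : is_qmorph (qlin v).
Proof.
split=> [A|a h]; apply: eq_le_above => z; rewrite /qlin.
- rewrite bigvee_rangeP bigvee_imageP.
  split=> [zA h Ah|zA x].
    apply/bigvee_rangeP => x; have := zA x.
    by rewrite qscale_bigveel image_comp bigvee_imageP; apply.
  rewrite qscale_bigveel image_comp bigvee_imageP => h /zA.
  by rewrite bigvee_rangeP; apply.
- rewrite qscale_bigveer image_comp !bigvee_rangeP.
  by split=> + x => /(_ x) /=; rewrite qscaleA.
Qed.

Lemma qmorph_qlin M N (f : M -> N) (v : X -> M) (h : qpow Q X) :
  is_qmorph f -> f (qlin v h) = qlin (f \o v) h.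
Proof.
move=> [fV fZ]; rewrite /qlin fV image_comp; congr bigvee.
by apply: eq_imagel => x _ /=; rewrite fZ.
Qed.

Lemma qlinE (v : X -> qpow Q X) (h : qpow Q X) (y : X) :
  qlin v h y = bigvee (range (fun x => (h x * v x y)%g)).
Proof. by rewrite [LHS]/(bigvee _) image_comp. Qed.

(* The join is [1] if [x = y], and the join of the empty set otherwise. *)
Definition qunit (x : X) : qpow Q X :=
  fun y => bigvee [set a | a = 1%g /\ x = y].

Lemma qlin_basis (h : qpow Q X) : qlin qunit h = h.
Proof.
apply/funext => y; rewrite qlinE; apply: eq_le_above => z.
rewrite bigvee_rangeP; split=> [/(_ y)|hz x]; rewrite mul_bigveer bigvee_imageP.
- by move=> /(_ 1%g); rewrite mulg1; exact.
- by move=> _ [-> ->]; rewrite mulg1.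
Qed.

Lemma qlin_qunit M (v : X -> M) (x : X) : qlin v (qunit x) = v x.
Proof.
apply: eq_le_above => z; rewrite bigvee_rangeP.
split=> [/(_ x)|vz y]; rewrite qscale_bigveel bigvee_imageP.
- by move=> /(_ 1%g); rewrite qscale1; exact.
- by move=> _ [-> <-]; rewrite qscale1.
Qed.

(** Lift the values of [f \o r] on the basis through [e], extend linearly and precompose with
    [i]. *)
Lemma retract_projective M (i : M -> qpow Q X) (r : qpow Q X -> M) :
  is_qmorph i -> is_qmorph r -> cancel i r -> projective M.
Proof.
move=> iM rM irK N P e f e_epi fM.
have e_surj p : exists n, e n = p.
  by have [n _ <-] : range e p by [rewrite epi_surjective]; exists n.
have [v ev] := choice (fun x => e_surj (f (r (qunit x)))).
exists (qlin v \o i); first exact: qmorph_comp (qlin_morph v) iM.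
apply/funext => m /=; rewrite (qmorph_qlin _ _ e_epi.1).
have -> : e \o v = (f \o r) \o qunit by apply/funext => x /=; rewrite ev.
by rewrite -qmorph_qlin ?qlin_basis /= ?irK //; exact: qmorph_comp.
Qed.

End Free.

(** * Submodules and spans *)

Section Span.
Variables (Q : unitalQuantaleType) (M N : leftQModType Q).

Lemma sub_qspan (G : set M) : G `<=` qspan G.
Proof. by move=> v Gv S [_]; exact. Qed.

Lemma qspan_sub (G S : set M) : is_submodule S -> G `<=` S -> qspan G `<=` S.
Proof. by move=> subS sGS v; apply. Qed.

Lemma gen_submod_val_morph (G : set M) : is_qmorph (val : gen_submod G -> M).
Proof. by []. Qed.

Lemma preimage_submodule (f : M -> N) (S : set N) :
  is_qmorph f -> is_submodule S -> is_submodule (f @^-1` S).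
Proof.
move=> [fV fZ] [SV SZ]; split=> [A sAS|a v Sv] /=.
- by rewrite fV; apply: SV => _ [v /sAS Sv <-].
- by rewrite fZ; exact: SZ.
Qed.

Lemma range_submodule (f : M -> N) : is_qmorph f -> is_submodule (range f).
Proof.
move=> [fV fZ]; split=> [A sAS|a _ [v _ <-]]; last by exists (a *> v).
(* Every element of [A] is a value of [f], so [f] maps the preimage of [A] onto [A]. *)
exists (bigvee (f @^-1` A)) => //; rewrite fV; congr bigvee.
apply/seteqP; split=> [_ [v Av <-] //|w Aw].
by have [v _ vw] := sAS _ Aw; exists v; rewrite /= ?vw.
Qed.

(** Serves to extend an equality of morphisms from generators to their span. *)
Lemma equalizer_submodule (f g : M -> N) :
  is_qmorph f -> is_qmorph g -> is_submodule [set v | f v = g v].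
Proof.
move=> [fV fZ] [gV gZ]; split=> [A sA|a v /= Ev]; last by rewrite fZ gZ Ev.
by rewrite /= fV gV; congr bigvee; apply: eq_imagel => v /sA.
Qed.

End Span.

Theorem theorem2p4 (Q : unitalQuantaleType) (M : leftQModType Q) (X : set M)
    (genX : generates X) :
  projective M <->
  exists k : qpow Q (X * X),
    kstar k k = k /\ qmod_iso M (gen_submod (range (krow k))).
Proof.
split=> [projM|[k [kk [f [g [fM gM fK _]]]]]].
(* Generation makes [pi] surjective, hence epi, and projectivity splits it. *)
- pose gen : X -> M := val; pose pi := qlin gen.
  have piM : is_qmorph pi by exact: qlin_morph.
  have pi_epi : is_epi pi.
    apply: surjective_epi => //; apply/seteqP; split=> // m _.
    have : qspan X m by rewrite genX.
    apply: (@qspan_sub _ _ X (range pi)); first exact: range_submodule.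
    move=> x Xx; exists (qunit Q (SigSub (mem_set Xx) : X)) => //.
    exact: qlin_qunit.
  have [s sM pis] := projM _ _ _ _ pi_epi (qmorph_id M).
  have sK : cancel s pi by move=> m; exact: (congr1 (fun f => f m) pis).
  pose k : qpow Q (X * X) := fun p => s (gen p.1) p.2.
  have krowE : krow k = s \o gen by [].
  exists k; split.
    (* Expanding [s (pi (s x)) = s x] by linearity of [s] gives the idempotence of [k]. *)
    apply/funext => -[x y]; rewrite /kstar /k /= -[in RHS](sK (gen x)).
    by rewrite (qmorph_qlin _ _ sM) qlinE.
  have s_span m : s m \in qspan (range (krow k)).
    apply/mem_set; have : qspan X m by rewrite genX.
    apply: (@qspan_sub _ _ X (s @^-1` qspan (range (krow k)))).
      exact: preimage_submodule sM (qspan_submodule _).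
    by move=> x Xx; apply: sub_qspan; exists (SigSub (mem_set Xx)).
  exists (fun m => exist _ (s m) (s_span m)), (pi \o val).
  split.
  + split=> [A|a v]; apply: val_inj => /=; first by rewrite sM.1 image_comp.
    by rewrite sM.2.
  + exact: qmorph_comp piM (gen_submod_val_morph _).
  + exact: sK.
  + move=> u; apply: val_inj => /=.
    (* [s \o pi] fixes every row [s (gen x)] since [pi \o s] is the identity, hence it fixes their
       span. *)
    suff : qspan (range (krow k)) `<=` [set h | (s \o pi) h = id h].
      by apply; exact: gen_submodP.
    apply: qspan_sub.
      by apply: equalizer_submodule; [exact: qmorph_comp|exact: qmorph_id].
    by move=> _ [x _ <-]; rewrite /= krowE /= sK.
- have row_span x : krow k x \in qspan (range (krow k)).
    by apply: mem_set; apply: sub_qspan; exists x.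
  pose row x : gen_submod (range (krow k)) := exist _ (krow k x) (row_span x).
  (* Idempotence says that combining the rows with coefficients [krow k x] returns [krow k x]; so
     [qlin row] fixes the rows, and with them their span. *)
  have rK : cancel val (qlin row).
    move=> u; apply: val_inj.
    rewrite (qmorph_qlin _ _ (gen_submod_val_morph _)).
    suff : qspan (range (krow k)) `<=` [set h | qlin (val \o row) h = id h].
      by apply; exact: gen_submodP.
    apply: qspan_sub.
      by apply: equalizer_submodule; [exact: qlin_morph|exact: qmorph_id].
    move=> _ [x _ <-] /=; apply/funext => y; rewrite qlinE.
    exact: (congr1 (fun h => h (x, y)) kk).
  apply: (@retract_projective _ _ _ (val \o f) (g \o qlin row)).
  + exact: qmorph_comp (gen_submod_val_morph _) fM.
  + exact: qmorph_comp gM (qlin_morph _).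
  + by move=> m /=; rewrite rK fK.
Qed.
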